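(* For every integer $n\ge 4$, $$\begin{aligned}A_n=\ &2\cdot2^{d_{n,1}}\cdot(d_{n,1})!\cdot(b_{n,1}-d_{n,1})!\cdot\prod_{j=2}^{n-1}2^{d_{n,j}}\cdot(b_{n,j})!\\&+2\cdot2^{d_{n-1,1}}\cdot(d_{n-1,1}+1)!\cdot(b_{n-1,1}-d_{n-1,1})!\cdot\prod_{j=2}^{n-1}2^{d_{n-1,j}}\cdot(b_{n-1,j})!\\&+\sum_{i=3}^{n-2}\Bigl[2^{d_{i,1}+d_{n+1-i,1}}\cdot(d_{i,1}+d_{n+1-i,1})!\cdot(b_{i,1}+b_{n+1-i,1}-d_{i,1}-d_{n+1-i,1})!\\&\qquad\quad\cdot\prod_{j=2}^{n-1}2^{d_{i,j}+d_{n+1-i,j}}\cdot(b_{i,j}+b_{n+1-i,j})!\Bigr].\end{aligned}$$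
   Context: Places $1,\dots,n$ stand in a row; neighbouring places have distance $1$. At any time at which at least one place is occupied, the distance of an empty place $x$ is $\min|x-y|$ over all occupied places $y$. Persons arrive one after another and each occupies one empty place. Basic politeness rule: every person except the first (who chooses freely unless stated otherwise) occupies one of the empty places whose distance is maximal among all empty places at that time. Extended politeness rule: every person except the first (who chooses freely) occupies one of the empty places of maximal distance, and among these one for which the number of occupied places directly neighbouring it is as small as possible. $A_n$ is the number of sequences $(x_1,\dots,x_n)$ (permutations of $\{1,\dots,n\}$, $x_t$ being the place taken by the $t$-th person) in which $n$ persons fill all $n$ places obeying the extended politeness rule. For positive integers $p,k$, consider $p$ places filled by $p$ persons according to the basic politeness rule with the first person taking the leftmost place. $b_{p,k}$ is the number of persons (the first person is not counted) who, at the moment of choosing, occupy a place of distance exactly $k$. $d_{p,k}$ (also for $k=1$) is the number of different sets of two neighbouring places for which, at some time during the filling, both places are empty and both have distance exactly $k$. These numbers do not depend on the choices made during the filling. Empty sums equal $0$. *)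

(* Defs.v *)
From mathcomp Require Import all_boot all_fingroup all_algebra.

Set Implicit Arguments.
Unset Strict Implicit.
Unset Printing Implicit Defensive.

(* Places are numbered from 0, as elements of 'I_p.  The order in which p      *)
(* persons fill the p places is a permutation s, where s t is the place taken  *)
(* by the person arriving after exactly t others.                              *)

(* The places taken by the first t persons.                                    *)
Definition occupied (p : nat) (s : {perm 'I_p}) (t : nat) : {set 'I_p} :=
  [set s u | u : 'I_p & u < t].

(* The value p returned when occ is empty is a dummy: distances between two    *)
(* places are smaller than p, so it never affects the minimum otherwise.       *)
Definition dist (p : nat) (occ : {set 'I_p}) (x : 'I_p) : nat :=
  \big[minn/p]_(y in occ) `|x - y|%N.

Definition basic_choice (p : nat) (occ : {set 'I_p}) (x : 'I_p) : bool :=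
  (x \notin occ) &&
  [forall y : 'I_p, (y \notin occ) ==> (dist occ y <= dist occ x)].

Definition occupied_neighbours (p : nat) (occ : {set 'I_p}) (x : 'I_p) : nat :=
  #|[set y in occ | `|x - y|%N == 1]|.

Definition extended_choice (p : nat) (occ : {set 'I_p}) (x : 'I_p) : bool :=
  basic_choice occ x &&
  [forall y : 'I_p, basic_choice occ y ==>
     (occupied_neighbours occ x <= occupied_neighbours occ y)].

Definition basic_filling (p : nat) (s : {perm 'I_p}) : bool :=
  [forall t : 'I_p, (0 < t) ==> basic_choice (occupied s t) (s t)].

Definition extended_filling (p : nat) (s : {perm 'I_p}) : bool :=
  [forall t : 'I_p, (0 < t) ==> extended_choice (occupied s t) (s t)].

Definition first_leftmost (p : nat) (s : {perm 'I_p}) : bool :=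
  [forall t : 'I_p, (t == 0 :> nat) ==> (s t == 0 :> nat)].

Definition A (n : nat) : nat := #|[set s : {perm 'I_n} | extended_filling s]|.

Definition persons_at_distance (p : nat) (s : {perm 'I_p}) (k : nat) : nat :=
  #|[set t : 'I_p | (0 < t) && (dist (occupied s t) (s t) == k)]|.

(* A set of two neighbouring places is represented by the pair (x, x + 1).     *)
(* Times t < p suffice, since after p persons no place is empty.               *)
Definition pairs_at_distance (p : nat) (s : {perm 'I_p}) (k : nat) : nat :=
  #|[set e : 'I_p * 'I_p | (e.2 == e.1.+1 :> nat) &&
      [exists t : 'I_p, [&& 0 < t,
         e.1 \notin occupied s t, e.2 \notin occupied s t,
         dist (occupied s t) e.1 == k & dist (occupied s t) e.2 == k]]]|.

(* m is the number b_{p,k}, resp. d_{p,k}, read off from some filling of p     *)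
(* places obeying the basic rule with the first person at the left end.  Since *)
(* such fillings always exist, a statement about all m with this property      *)
(* covers every choice of the filling and does not presuppose that the number  *)
(* is independent of that choice.                                              *)
Definition is_b (p k m : nat) : Prop :=
  exists s : {perm 'I_p},
    [/\ basic_filling s, first_leftmost s & m = persons_at_distance s k].

Definition is_d (p k m : nat) : Prop :=
  exists s : {perm 'I_p},
    [/\ basic_filling s, first_leftmost s & m = pairs_at_distance s k].

(* Main.v *)
(* The occupied places cut the row into gaps, and the politeness rule halves an
   inner gap, or takes the outermost place of a gap at an end of the row. Hence
   the multiset of gap lengths still to appear depends only on the present gaps,
   and b and d are additive functionals of the gaps, each choice lowering them by
   the contribution of the gap it splits. While the maximal distance is j >= 2,
   the gaps of maximal distance j are split in any order, with two choices for
   each inner gap of even length. At distance 1, the gaps offering a place with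
   a single occupied neighbour (inner gaps of length 2, end gaps of length 1) come
   first, then the isolated places. The resulting product therefore satisfies the
   recursion for the number of completions of a partial filling; evaluating it
   when only the first person sits, at place i, gives the i-th summand. *)

Require Import Defs.
From mathcomp Require Import all_boot all_fingroup all_algebra.
From mathcomp Require Import zify.

Set Implicit Arguments.
Unset Strict Implicit.
Unset Printing Implicit Defensive.

(** * Gaps of a set of numbers, and sums over gaps *)

Section Gaps.

Implicit Types M : pred nat.

(* Consecutive elements a < b of M; the gap itself is a+1, ..., b-1. *)
Definition gap M a b :=
  [&& a < b, M a, M b & all (fun c => ~~ M c) (iota a.+1 (b - a.+1))].

Lemma gapP M a b :
  reflect [/\ a < b, M a, M b & forall c, a < c -> c < b -> M c = false]
          (gap M a b).
Proof.
apply: (iffP and4P) => [[ab Ma Mb /allP H]|[ab Ma Mb H]]; split=> //.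
  move=> c ac cb; apply/negbTE/H; rewrite mem_iota; lia.
by apply/allP => c; rewrite mem_iota => hc; rewrite H //; lia.
Qed.

Lemma gap_unique M a b a' b' x :
  gap M a b -> gap M a' b' -> a < x < b -> a' < x < b' -> a = a' /\ b = b'.
Proof.
case/gapP=> ab Ma Mb H /gapP[ab' Ma' Mb' H'] hx hx'.
have := H a'; have := H b'; have := H' a; have := H' b.
rewrite Ma Mb Ma' Mb' => h1 h2 h3 h4.
have {h1} : ~ (a' < b /\ b < b') by move=> [u v]; have := h1 u v.
have {h2} : ~ (a' < a /\ a < b') by move=> [u v]; have := h2 u v.
have {h3} : ~ (a < b' /\ b' < b) by move=> [u v]; have := h3 u v.
have {h4} : ~ (a < a' /\ a' < b) by move=> [u v]; have := h4 u v.
lia.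
Qed.

Lemma gap_exists M N x :
  M 0 -> M N -> ~~ M x -> x < N ->
  exists a b, [/\ gap M a b, a < x, x < b & b <= N].
Proof.
move=> M0 MN Mx xN.
have exa : exists a, (a <= x) && M a by exists 0.
have exb : exists b, (x <= b) && M b by exists N; rewrite ltnW.
have bnd a : (a <= x) && M a -> a <= x by case/andP.
case: (ex_maxnP exa bnd) => a /andP[ax Ma] amax.
case: (ex_minnP exb) => b /andP[xb Mb] bmin.
have ax' : a < x by rewrite ltn_neqAle ax andbT; apply: contraNneq Mx => <-.
have xb' : x < b by rewrite ltn_neqAle xb andbT; apply: contraNneq Mx => ->.
exists a, b; split=> //; last by apply: bmin; rewrite MN ltnW.
apply/gapP; split=> //; first exact: ltn_trans xb'.
move=> c ac cb; apply/negP => Mc; case: (leqP c x) => cx.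
  by have := amax c; rewrite cx Mc => /(_ isT); lia.
by have := bmin c; rewrite ltnW // Mc => /(_ isT); lia.
Qed.

Lemma gap_insert M M' a b z :
  gap M a b -> a < z < b -> (forall k, M' k = (k == z) || M k) ->
  forall c d, gap M' c d =
    [|| (c == a) && (d == z), (c == z) && (d == b)
      | gap M c d && ~~ ((c == a) && (d == b))].
Proof.
move=> /gapP[ab Ma Mb H] hz hM' c d.
have Mz : M z = false by apply: H; lia.
apply/gapP/idP; rewrite ?hM'.
  case=> cd Mc Md H'.
  have Hz : ~ (c < z /\ z < d).
    by case=> u v; have := H' z u v; rewrite hM' eqxx.
  have Ha : ~ (c < a /\ a < d).
    by case=> u v; have := H' a u v; rewrite hM' Ma orbT.
  have Hb : ~ (c < b /\ b < d).
    by case=> u v; have := H' b u v; rewrite hM' Mb orbT.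
  have Hc : M c -> ~ (a < c /\ c < b) by move=> u [v w]; rewrite H in u.
  have Hd : M d -> ~ (a < d /\ d < b) by move=> u [v w]; rewrite H in u.
  case: (eqVneq c z) Mc => [cz _|cz /= Mc].
    case: (eqVneq d z) Md => [|_ /= Md]; first lia.
    move/(_ Md) in Hd; have -> : d == b by lia.
    by rewrite orbT.
  move/(_ Mc) in Hc.
  case: (eqVneq d z) Md => [dz _|dz /= Md]; first by have -> : c == a by lia.
  move/(_ Md) in Hd.
  apply/orP; right; apply/andP; split; last lia.
  apply/gapP; split=> // k ck kd.
  by have := H' k ck kd; rewrite hM' => /negbT; rewrite negb_or => /andP[_ /negbTE].
case/or3P=> [/andP[/eqP-> /eqP->]|/andP[/eqP-> /eqP->]|/andP[/gapP[cd Mc Md H'] ne]].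
- rewrite Ma eqxx orbT; split=> //; first lia.
  by move=> k ak kz; rewrite hM' H ?orbF; lia.
- rewrite Mb eqxx orbT; split=> //; first lia.
  by move=> k ak kz; rewrite hM' H ?orbF; lia.
rewrite Mc Md !orbT; split=> // k ck kd; rewrite hM' H' // orbF.
have Ha : ~ (c < a /\ a < d) by case=> u v; rewrite H' in Ma.
have Hb : ~ (c < b /\ b < d) by case=> u v; rewrite H' in Mb.
have Hc : ~ (a < c /\ c < b) by case=> u v; rewrite H in Mc.
have Hd : ~ (a < d /\ d < b) by case=> u v; rewrite H in Md.
lia.
Qed.

Definition gap_sum M N (g : nat -> nat -> nat) :=
  \sum_(e : 'I_N * 'I_N | gap M e.1 e.2) g e.1 e.2.

Lemma gap_sum_split M N (g : nat -> nat -> nat) a b :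
  gap M a b -> b < N ->
  gap_sum M N g =
    g a b + \sum_(e : 'I_N * 'I_N |
                   gap M e.1 e.2 && ~~ ((e.1 == a :> nat) && (e.2 == b :> nat)))
              g e.1 e.2.
Proof.
move=> gab bN; have ab : a < b by case/gapP: gab.
have aN : a < N by lia.
rewrite /gap_sum (bigD1 (Ordinal aN, Ordinal bN)) //=; congr (_ + _).
Qed.

(** The gaps other than [a, b] contribute equally to both sides; [g a b] stands on the left to avoid
    truncated subtraction. *)
Lemma gap_sum_insert M M' N g a b z :
  gap M a b -> b < N -> a < z < b -> (forall k, M' k = (k == z) || M k) ->
  gap_sum M' N g + g a b = g a z + g z b + gap_sum M N g.
Proof.
move=> gab bN hz hM'; have hM'g := gap_insert gab hz hM'.
have gaz : gap M' a z by rewrite hM'g !eqxx.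
have gzb : gap M' z b by rewrite hM'g !eqxx orbT.
rewrite (gap_sum_split g gab) //.
have zN : z < N by lia.
rewrite (gap_sum_split g gaz) //.
have -> : \sum_(e : 'I_N * 'I_N | gap M' e.1 e.2 && ~~ ((e.1 == a :> nat) && (e.2 == z :> nat))) g e.1 e.2
  = g z b + \sum_(e : 'I_N * 'I_N | gap M e.1 e.2 && ~~ ((e.1 == a :> nat) && (e.2 == b :> nat))) g e.1 e.2.
  rewrite (bigD1 (Ordinal zN, Ordinal bN)) /=; last by rewrite gzb /=; lia.
  congr (_ + _); apply: eq_bigl => -[c d] /=.
  rewrite hM'g xpair_eqE -!val_eqE /=.
  have := gap_unique gab.
  case: (boolP (gap M c d)) => /= [gcd|_] _.
    case/gapP: gcd => cd Mc Md _; case/gapP: gab => ab Ma Mb H.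
    have Hc : c <> z :> nat by move=> E; rewrite E H in Mc; lia.
    have Hd : d <> z :> nat by move=> E; rewrite E H in Md; lia.
    lia.
  lia.
lia.
Qed.

(** Exchanging the sums works because exactly one gap surrounds each number outside [M], by
    [gap_exists] and [gap_unique]. The bound [N.+1] admits [N] itself as an end. *)
Lemma sum_over_gaps M N n (h : 'I_n -> nat) : M 0 -> M N -> n < N ->
  \sum_(x < n | ~~ M x.+1) h x =
  gap_sum M N.+1 (fun a b => \sum_(x < n | a < x.+1 < b) h x).
Proof.
move=> M0 MN nN; rewrite /gap_sum.
rewrite (exchange_big_dep xpredT) //= big_mkcond; apply: eq_bigr => x _.
case: ifPn => Mx; last first.
  rewrite big_pred0 // => -[a b] /=; apply/negP => /andP[/gapP[_ _ _ H] hx].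
  by rewrite H in Mx; lia.
have xN : x.+1 < N by apply: leq_ltn_trans nN.
case: (gap_exists M0 MN Mx xN) => a [b [gab ax xb bN]].
have bN' : b < N.+1 by [].
have aN' : a < N.+1 by lia.
rewrite (big_pred1 (Ordinal aN', Ordinal bN')) // => -[c d] /=.
rewrite xpair_eqE -!val_eqE /=; apply/andP/andP => [[gcd hx]|[/eqP-> /eqP->]].
  by have [|->->] := gap_unique gcd gab hx; rewrite ?ax.
by split=> //; rewrite ax.
Qed.

End Gaps.

(** * Distance and occupied neighbours of a place in terms of its gap *)

Section Places.

Variable p : nat.
Implicit Types (O : {set 'I_p}) (x y z : 'I_p).

(* Place x of 'I_p gets coordinate x.+1, so that 0 and p.+1 can stand as
   sentinels bounding the gaps at the two ends of the row. *)
Definition taken O : pred nat :=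
  fun k => [|| k == 0, k == p.+1 | [exists x in O, x.+1 == k :> nat]].

Lemma takenS O x : taken O x.+1 = (x \in O).
Proof.
rewrite /taken /= eqSS ltn_eqF //=; apply/existsP/idP => [[y /andP[yO]]|xO].
  by rewrite eqSS => /eqP/val_inj <-.
by exists x; rewrite xO /=.
Qed.

Lemma takenP O k : taken O k -> [\/ k = 0, k = p.+1 | exists2 x, x \in O & k = x.+1].
Proof.
case/or3P=> [/eqP->|/eqP->|/existsP[x /andP[xO /eqP<-]]]; first by constructor 1.
  by constructor 2.
by constructor 3; exists x.
Qed.

Lemma taken0 O : taken O 0. Proof. by []. Qed.

Lemma takenp O : taken O p.+1. Proof. by rewrite /taken eqxx orbT. Qed.

Lemma taken_insert O z k : taken (z |: O) k = (k == z.+1) || taken O k.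
Proof.
rewrite /taken.
have -> : [exists x in z |: O, x.+1 == k :> nat] =
          (k == z.+1) || [exists x in O, x.+1 == k :> nat].
  apply/existsP/orP => [[x]|[/eqP->|/existsP[x /andP[xO xk]]]].
  - rewrite in_setU1 => /andP[/orP[/eqP->|xO] xk]; first by left; rewrite eq_sym.
    by right; apply/existsP; exists x; rewrite xO.
  - by exists z; rewrite setU11 eqxx.
  by exists x; rewrite in_setU1 xO orbT.
by case: (k == 0); case: (k == p.+1); case: (k == z.+1).
Qed.

Lemma gap_le O a b : gap (taken O) a b -> a < b <= p.+1.
Proof.
case/gapP=> ab _ /takenP Hb _; rewrite ab /=; case: Hb => [->|->|[x _ ->]] //.
exact: leqW (ltn_ord x).
Qed.

(** A seated person lies strictly between the sentinels. This is why [gap_dist] may test the two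
    ends of a gap in turn. *)
Lemma gap_proper O a b x : gap (taken O) a b -> x \in O -> (a == 0) && (b == p.+1) = false.
Proof.
case/gapP=> ab _ _ H xO; apply/negP => /andP[/eqP a0 /eqP bp].
have := H x.+1; rewrite takenS xO a0 bp => /(_ isT); rewrite ltnS ltn_ord => /(_ isT).
by [].
Qed.

Lemma gap_empty O a b x : gap (taken O) a b -> a < x.+1 -> x.+1 < b -> x \notin O.
Proof. by case/gapP=> ab _ _ H ax xb; rewrite -takenS H. Qed.

Lemma empty_gap O x : x \notin O ->
  exists a b, [/\ gap (taken O) a b, a < x.+1, x.+1 < b & b <= p.+1].
Proof.
rewrite -takenS => xO.
by apply: gap_exists (taken0 O) (takenp O) xO _; rewrite ltnS.
Qed.

Definition at_end a b := (a == 0) || (b == p.+1).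

(** A sentinel is not a person, so in an end gap only the other end counts. *)
Definition gap_dist a b k :=
  if a == 0 then b - k else if b == p.+1 then k - a else minn (k - a) (b - k).

Definition gap_max a b := if at_end a b then b - a.+1 else (b - a)./2.

Lemma dist_le O x y : y \in O -> dist O x <= `|x - y|%N.
Proof.
move=> yO; rewrite /dist -big_filter.
have: y \in [seq i <- index_enum _ | i \in O] by rewrite mem_filter yO mem_index_enum.
elim: [seq _ <- _ | _] => // z s IHs; rewrite inE big_cons geq_min => /orP[/eqP->|/IHs->].
  by rewrite leqnn.
by rewrite orbT.
Qed.

Lemma dist_geq O x v : v <= p -> (forall y, y \in O -> v <= `|x - y|%N) -> v <= dist O x.
Proof.
move=> vp H; rewrite /dist; elim/big_rec: _ => // y u /H h1 h2.
by rewrite leq_min h1.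
Qed.

Lemma dist_gap O a b x : O != set0 -> gap (taken O) a b -> a < x.+1 < b ->
  dist O x = gap_dist a b x.+1.
Proof.
case/set0Pn=> y0 y0O gab /andP[ax xb].
have := gap_proper gab y0O; have /andP[ab bp] := gap_le gab.
case/gapP: gab => _ Ma Mb H Hp.
have Hy y : y \in O -> y.+1 <= a \/ b <= y.+1.
  move=> yO; case: (leqP y.+1 a) => h; first by left.
  by right; rewrite leqNgt; apply/negP => h'; move: (H _ h h'); rewrite takenS yO.
have xp := ltn_ord x.
apply/eqP; rewrite eqn_leq; apply/andP; split; last first.
  apply: dist_geq => [|y yO]; rewrite /gap_dist.
    by case: eqP => ?; [|case: eqP]; lia.
  have := ltn_ord y; have := Hy y yO; move: Hp.
  by case: eqP => ?; [|case: eqP]; lia.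
have HA : a <> 0 -> dist O x <= x.+1 - a.
  case/takenP: Ma => [//|ap|[y yO ay]] _; first lia.
  by apply: leq_trans (dist_le x yO) _; lia.
have HB : b <> p.+1 -> dist O x <= b - x.+1.
  case/takenP: Mb => [b0|//|[y yO bY]] _; first lia.
  by apply: leq_trans (dist_le x yO) _; lia.
rewrite /gap_dist; case: eqP Hp => [a0|a0] /=; first by move/eqP/HB.
by case: eqP => [bp'|/HB hb] _; have := HA a0; lia.
Qed.

(** Place [x] has coordinate [x.+1], so its neighbours have coordinates [x] and [x.+2]; an occupied
    one is an end of the gap, and sentinels do not count. *)
Lemma occupied_neighbours_gap O a b x :
  gap (taken O) a b -> a < x.+1 < b ->
  occupied_neighbours O x =
    ((a == x) && (a != 0)) + ((b == x.+2) && (b != p.+1)).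
Proof.
move=> gab /andP[ax xb]; rewrite /occupied_neighbours.
case/gapP: gab => ab Ma Mb H.
have xp := ltn_ord x.
have -> : [set y in O | `|x - y|%N == 1] =
  [set y in O | y.+1 == x :> nat] :|: [set y in O | y == x.+1 :> nat].
  apply/setP => y; rewrite !inE; case: (y \in O) => //=; lia.
rewrite cardsU.
have -> : [set y in O | y.+1 == x :> nat] :&: [set y in O | y == x.+1 :> nat] = set0.
  apply/setP => y; rewrite !inE; case: (y \in O) => //=; lia.
rewrite cards0 subn0; congr (_ + _).
  case: (altP (a =P x)) => [ax'|ax'] /=; last first.
    apply: eq_card0 => y; rewrite !inE; apply/negP => /andP[yO yx].
    by have := H y.+1; rewrite takenS yO; lia.
  case/takenP: Ma => [a0|ap|[y yO ay]]; last 1 first.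
  - have -> : a != 0 by lia.
    apply: (@eq_card1 _ y) => z; rewrite !inE.
    by apply/andP/eqP => [[_ zx]|->]; [apply/val_inj => /=|split]; lia.
  - by rewrite a0 /=; apply: eq_card0 => y; rewrite !inE; lia.
  lia.
case: (altP (b =P x.+2)) => [bx'|bx'] /=; last first.
  apply: eq_card0 => y; rewrite !inE; apply/negP => /andP[yO yx].
  by have := H y.+1; rewrite takenS yO; lia.
case/takenP: Mb => [b0|bp|[y yO ay]]; first lia.
  rewrite bp eqxx; apply: eq_card0 => y; rewrite !inE.
  by have := ltn_ord y; lia.
have -> : b != p.+1 by have := ltn_ord y; lia.
apply: (@eq_card1 _ y) => z; rewrite !inE.
by apply/andP/eqP => [[_ zx]|->]; [apply/val_inj => /=|split]; lia.
Qed.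

Lemma gap_dist_max a b k : a < k < b -> gap_dist a b k <= gap_max a b.
Proof.
by rewrite /gap_dist /gap_max /at_end; case: eqP => ? /=; [|case: eqP => ? /=]; lia.
Qed.

Lemma gap_max_attained a b : a.+1 < b -> b <= p.+1 ->
  exists2 x : 'I_p, a < x.+1 < b & gap_dist a b x.+1 = gap_max a b.
Proof.
move=> ab bp; rewrite /gap_dist /gap_max /at_end.
case: eqP => a0 /=.
  have h : a < p by lia.
  by exists (Ordinal h) => /=; lia.
case: eqP => bp' /=.
  have h : b.-2 < p by lia.
  by exists (Ordinal h) => /=; lia.
have h : (a + (b - a)./2).-1 < p by lia.
by exists (Ordinal h) => /=; lia.
Qed.

End Places.

(** * Sums over the repeated halving of a gap *)

(* halving_sum c m adds up c over the lengths of all nonempty gaps that ever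
   appear while an inner gap of length m is filled, itself included. *)
Fixpoint halving_sum_rec (c : nat -> nat) fuel m :=
  if fuel is f.+1 then
    if m is m'.+1 then c m + halving_sum_rec c f m'./2 + halving_sum_rec c f (uphalf m') else 0
  else 0.

Definition halving_sum c m := halving_sum_rec c m m.

Lemma halving_sum_recE c f m : m <= f -> halving_sum_rec c f m = halving_sum c m.
Proof.
rewrite /halving_sum; elim/ltn_ind: m f => -[|m] IH [|f] //= mf.
have h1 : m./2 <= m by lia.
have h2 : uphalf m <= m by lia.
congr (_ + _ + _).
  by rewrite IH ?(IH _ _ m) //; lia.
by rewrite IH ?(IH _ _ m) //; lia.
Qed.

Lemma halving_sum0 c : halving_sum c 0 = 0. Proof. by []. Qed.

Lemma halving_sumS c m : halving_sum c m.+1 = c m.+1 + halving_sum c m./2 + halving_sum c (uphalf m).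
Proof. by rewrite {1}/halving_sum /= !halving_sum_recE //; lia. Qed.

Lemma halving_sum_eq0 c m : (forall i, i <= m -> c i = 0) -> halving_sum c m = 0.
Proof.
elim/ltn_ind: m => -[|m] IH H; rewrite ?halving_sum0 // halving_sumS H // !IH //; try lia.
  by move=> i hi; apply: H; lia.
by move=> i hi; apply: H; lia.
Qed.

(** With [uphalf m <= l] the two pieces have length at most [l], and [1 < l] puts their maximal
    distance below [l]. All later gaps therefore weigh nothing. *)
Lemma halving_sum_local l c m : 1 < l -> uphalf m <= l ->
  (forall i, uphalf i < l -> c i = 0) -> c 0 = 0 -> halving_sum c m = c m.
Proof.
case: m => [|m] l1 ml H c0; first by rewrite halving_sum0 c0.
rewrite halving_sumS !halving_sum_eq0 ?addn0 //.
  by move=> i hi; apply: H; move: ml; rewrite /=; lia.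
by move=> i hi; apply: H; move: ml; rewrite /=; lia.
Qed.

(** * Potentials of the gaps, and the places of maximal distance *)

Section Potential.

Variable p : nat.
Implicit Types (O : {set 'I_p}) (x y z : 'I_p) (c ce : nat -> nat).

(** [c] weighs inner gaps and [ce] end gaps. An end gap of length [m.+1] loses its outermost place
    and becomes an inner gap of length [m]. *)
Definition gap_weight c ce a b :=
  if at_end p a b then (if b - a.+1 is m.+1 then ce m.+1 + halving_sum c m else 0)
  else halving_sum c (b - a.+1).

(* The contribution to a potential that is lost when the gap is split. *)
Definition gap_head c ce a b :=
  if at_end p a b then ce (b - a.+1) else c (b - a.+1).

Definition potential c ce O := gap_sum (taken O) p.+2 (gap_weight c ce).

Lemma gap_weight_split c ce a b k :
  a < k < b -> b <= p.+1 -> (a == 0) && (b == p.+1) = false ->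
  gap_dist p a b k = gap_max p a b ->
  gap_weight c ce a b = gap_head c ce a b + gap_weight c ce a k + gap_weight c ce k b.
Proof.
move=> hk bp Hp; rewrite /gap_dist /gap_max /gap_weight /gap_head /at_end.
case: (altP (a =P 0)) Hp => [a0|a0] /= Hp.
  rewrite Hp => hd; have -> : k = 1 by lia.
  rewrite a0 subnn /=.
  have -> : b - 1 = (b - 2).+1 by lia.
  by rewrite addn0.
case: (altP (b =P p.+1)) => [b0|b0] /= hd.
  have -> : b = k.+1 by lia.
  rewrite subnn orbT !ifF ?addn0; [|lia..].
  by have -> : k.+1 - a.+1 = (k - a.+1).+1 by lia.
rewrite !ifF; [|lia..].
have -> : b - a.+1 = (b - a.+2).+1 by lia.
rewrite halving_sumS -!addnA; congr (_ + _).
(* The two middle places of a gap of even length yield the same pieces in opposite order. *)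
have [[-> ->] //|[-> ->]] : (k - a.+1 = (b - a.+2)./2 /\ b - k.+1 = uphalf (b - a.+2))
  \/ (k - a.+1 = uphalf (b - a.+2) /\ b - k.+1 = (b - a.+2)./2) by lia.
by rewrite addnC.
Qed.

Definition level O := \max_(y | y \notin O) dist O y.

Lemma basic_choiceE O x :
  basic_choice O x = (x \notin O) && (dist O x == level O).
Proof.
rewrite /basic_choice; case: (boolP (x \notin O)) => //= xO.
rewrite eqn_leq leq_bigmax_cond //=; apply/forallP/bigmax_leqP => [H y yO|H y].
  exact: implyP (H y) yO.
by apply/implyP; apply: H.
Qed.

Lemma gap_max_level O a b : O != set0 -> gap (taken O) a b ->
  gap_max p a b <= level O.
Proof.
move=> O0 gab; have /andP[ab bp] := gap_le gab.
case: (ltnP a.+1 b) => ab'; last by rewrite /gap_max; case: ifP; lia.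
case: (gap_max_attained ab' bp) => x hx <-.
rewrite -(dist_gap O0 gab hx); apply: leq_bigmax_cond.
by case/andP: hx => *; apply: gap_empty gab _ _.
Qed.

(** In the chain [gap_dist <= gap_max <= level], reaching [level] forces equality at both links. *)
Lemma basic_choice_gap O a b x : O != set0 -> gap (taken O) a b -> a < x.+1 < b ->
  basic_choice O x =
    (gap_dist p a b x.+1 == gap_max p a b) && (gap_max p a b == level O).
Proof.
move=> O0 gab hx; rewrite basic_choiceE (dist_gap O0 gab hx).
have -> /= : x \notin O by case/andP: hx => *; apply: gap_empty gab _ _.
have h1 := gap_max_level O0 gab; have h2 := gap_dist_max p hx.
lia.
Qed.

Lemma level_gt0 O : O != set0 -> O != setT -> 0 < level O.
Proof.
move=> O0; rewrite -subTset => /subsetPn[x _ xO].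
apply: (@leq_trans (dist O x)); last by rewrite /level leq_bigmax_cond.
case: (empty_gap xO) => a [b [gab ax xb bp]].
rewrite (dist_gap O0 gab) ?ax //.
by rewrite /gap_dist; case: eqP => ?; [|case: eqP => ?]; lia.
Qed.

Lemma level_attained O : O != setT -> exists x, basic_choice O x.
Proof.
rewrite -subTset => /subsetPn[x _ xO].
have [y yO h] := @eq_bigmax_cond _ (fun y => y \notin O) (dist O) ltac:(by apply/card_gt0P; exists x).
by exists y; rewrite basic_choiceE /level h eqxx andbT.
Qed.

Lemma gap_max_lt O a b : O != set0 -> gap (taken O) a b -> 0 < p -> gap_max p a b < p.
Proof.
case/set0Pn=> x xO gab; have := gap_proper gab xO.
by have := gap_le gab; rewrite /gap_max /at_end; case: ifP; lia.
Qed.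

(** Only the gap around [x] changes, and a best place cuts it as the halving recursion does,
    whatever [c] and [ce] are. *)
Lemma potential_insert c ce O a b x : O != set0 -> gap (taken O) a b -> a < x.+1 < b ->
  basic_choice O x ->
  potential c ce O = gap_head c ce a b + potential c ce (x |: O).
Proof.
move=> O0 gab hx; rewrite (basic_choice_gap O0 gab hx) => /andP[/eqP hd _].
have /andP[ab bp] := gap_le gab.
have hp : (a == 0) && (b == p.+1) = false.
  by case/set0Pn: O0 => y; apply: gap_proper.
have bp' : b < p.+2 by [].
have := gap_sum_insert (gap_weight c ce) gab bp' hx (taken_insert O x).
rewrite (gap_weight_split c ce hx bp hp hd) /potential; lia.
Qed.

Lemma potential_full c ce : potential c ce [set: 'I_p] = 0.
Proof.
rewrite /potential /gap_sum big1 // => -[a b] /= gab.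
have /andP[ab bp] := gap_le gab.
have -> : nat_of_ord b = a.+1.
  apply/eqP; rewrite eqn_leq ab andbT leqNgt; apply/negP => ab'.
  have h : a < p by lia.
  by have := @gap_empty _ _ _ _ (Ordinal h) gab; rewrite inE /= ltnS leqnn; move/(_ isT ab').
by rewrite /gap_weight subnn halving_sum0; case: ifP.
Qed.

(** The length is [b - a.+1], so even length means odd [b - a]. *)
Definition inner_even a b := ~~ at_end p a b && odd (b - a).

(* Counted with weight 2 over the number of best places in the gap, the best
   places of every gap amount to 2; this makes odd, even and end gaps uniform. *)
Lemma sum_gap_choices a b : a.+1 < b -> b <= p.+1 -> (a == 0) && (b == p.+1) = false ->
  \sum_(x < p | (a < x.+1 < b) && (gap_dist p a b x.+1 == gap_max p a b))
     (2 - inner_even a b) = 2.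
Proof.
move=> ab bp hp; rewrite sum_nat_const.
rewrite /gap_dist /gap_max /inner_even /at_end.
case: (altP (a =P 0)) hp => [a0|a0] /= hp.
  have h : 0 < p by lia.
  rewrite (@eq_card1 _ (Ordinal h)) // => x; rewrite !inE -val_eqE /=; lia.
case: (altP (b =P p.+1)) => [b0|b0] /=.
  have h : b.-2 < p by lia.
  rewrite (@eq_card1 _ (Ordinal h)) // => x; rewrite !inE -val_eqE /=; lia.
have h1 : (a + (b - a)./2).-1 < p by lia.
case: (boolP (odd (b - a))) => /= od.
  have h2 : (a + (b - a)./2) < p by lia.
  rewrite (@eq_card _ _ (mem [set Ordinal h1; Ordinal h2])).
    by rewrite cards2 -val_eqE /=; lia.
  by move=> x; rewrite !inE -!val_eqE /=; lia.
rewrite (@eq_card1 _ (Ordinal h1)) // => x; rewrite !inE -val_eqE /=; lia.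
Qed.

(** [S] selects the gaps in which [C] allows a choice. Sorted by gap, the weights [2 - inner_even]
    of the best places add up to 2 in each selected gap. *)
Lemma sum_choices O (C : pred 'I_p) (S : nat -> nat -> bool) (h : 'I_p -> nat) K :
  O != set0 -> (forall x, C x -> x \notin O) -> (forall a b, S a b -> a.+1 < b) ->
  (forall a b x, gap (taken O) a b -> a < x.+1 < b ->
     C x = S a b && (gap_dist p a b x.+1 == gap_max p a b)) ->
  (forall a b x, gap (taken O) a b -> a < x.+1 < b -> C x ->
     h x = K * (2 - inner_even a b)) ->
  \sum_(x | C x) h x = K * 2 * gap_sum (taken O) p.+2 (fun a b => S a b).
Proof.
move=> O0 CO Slt HC Hh.
have -> : \sum_(x | C x) h x =
    \sum_(x < p | ~~ taken O x.+1) (if C x then h x else 0).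
  rewrite -big_mkcondr; apply: eq_bigl => x; rewrite takenS.
  by case: (boolP (C x)) => [/CO->|]; rewrite ?andbF.
rewrite (sum_over_gaps _ (taken0 O) (takenp O)) // /gap_sum big_distrr /=.
apply: eq_bigr => -[a b] /= gab; rewrite -big_mkcondr /=.
have hp : ((a : nat) == 0) && ((b : nat) == p.+1) = false.
  by case/set0Pn: O0 => y; apply: gap_proper.
case: (boolP (S a b)) => Sab; last first.
  by rewrite muln0 big_pred0 // => x; apply/negP => /andP[hx]; rewrite (HC _ _ _ gab hx) (negbTE Sab).
have bp : b <= p.+1 by rewrite -ltnS.
rewrite muln1 -[in RHS](sum_gap_choices (Slt _ _ Sab) bp hp) big_distrr /=.
apply: eq_big => [x|x /andP[hx Cx]]; last exact: Hh Cx.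
by apply: andb_id2l => hx; rewrite (HC _ _ _ gab hx) Sab.
Qed.

End Potential.

(** * The product formula and its recursion *)

Section Completions.

Variable p : nat.
Implicit Types (O : {set 'I_p}) (x y z : 'I_p).

(** Distances are strictly monotone in an end gap, and in an inner gap two neighbours are equally
    far only in the middle of an even gap. So a pair at distance [k] amounts to an inner gap of
    length [k.*2]. *)
Definition pairs_left k O :=
  potential (fun m => m == k.*2) (fun=> 0) O.

(** The maximal distance is [uphalf m] in an inner gap of length [m] and [m] in an end gap; each
    nonempty gap is split by one person. *)
Definition persons_left k O :=
  potential (fun m => uphalf m == k) (fun m => m == k) O.

(* The number of persons still to choose a place of distance 1 having a single
   occupied neighbour. *)
Definition early_left O :=
  potential (fun m => m == 2) (fun m => m == 1) O.

(** The factorials order, in turn, the early choices at distance 1, the other ones at distance 1,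
    and those at each [j >= 2]; the power of 2 records the choices between two middle places. *)
Definition completions O :=
  2 ^ (\sum_(1 <= j < p) pairs_left j O) * (early_left O)`!
  * (persons_left 1 O - early_left O)`!
  * \prod_(2 <= j < p) (persons_left j O)`!.

Definition early_gap a b := if at_end p a b then b == a.+2 else b == a.+3.

Lemma basic_choice_empty O x : basic_choice O x -> x \notin O.
Proof. by case/andP. Qed.

Lemma extended_choice_far O x : O != set0 -> 1 < level O ->
  extended_choice O x = basic_choice O x.
Proof.
move=> O0 l1; rewrite /extended_choice; case: (boolP (basic_choice O x)) => //= bx.
apply/forallP => y; apply/implyP => _; suff -> : occupied_neighbours O x = 0 by [].
case: (empty_gap (basic_choice_empty bx)) => a [b [gab ax xb bp]].
have hx : a < x.+1 < b by rewrite ax.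
move: bx; rewrite (basic_choice_gap O0 gab hx) (occupied_neighbours_gap gab hx).
rewrite /gap_dist => /andP[/eqP h1 /eqP h2]; rewrite -h1 in h2.
move: h2; case: eqP => a0; [|case: eqP => b0] => h2; lia.
Qed.

(** An inner gap of length 1 gives two occupied neighbours; an inner gap of length 2 or an end gap
    of length 1 gives one. *)
Lemma neighbours_level1 O a b x : O != set0 -> level O = 1 ->
  gap (taken O) a b -> a < x.+1 < b -> basic_choice O x ->
  occupied_neighbours O x = 2 - early_gap a b.
Proof.
move=> O0 l1 gab hx.
have hp : (a == 0) && (b == p.+1) = false.
  by case/set0Pn: O0 => y; apply: gap_proper.
have bp := gap_le gab.
rewrite (basic_choice_gap O0 gab hx) (occupied_neighbours_gap gab hx) l1.
rewrite /gap_dist /gap_max /early_gap /at_end => /andP[/eqP h1 /eqP h2].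
rewrite h2 in h1; move: h1 h2; case: (altP (a =P 0)) hp => a0 /= hp.
  rewrite hp => h1 h2; lia.
case: (altP (b =P p.+1)) => b0 /= h1 h2; lia.
Qed.

Lemma level1_gaps O a b : O != set0 -> level O = 1 -> gap (taken O) a b ->
  gap_max p a b <= 1.
Proof. by move=> O0 l1 gab; rewrite -l1 gap_max_level. Qed.

(** At level 1 inner gaps have length at most 2 and end gaps at most 1, and splitting them creates
    no new early gap. *)
Lemma early_leftE O : O != set0 -> level O = 1 ->
  early_left O = gap_sum (taken O) p.+2 (fun a b => early_gap a b).
Proof.
move=> O0 l1; apply: eq_bigr => -[a b] /= gab.
have := level1_gaps O0 l1 gab; have := gap_le gab.
rewrite /gap_max /gap_weight /early_gap; case: ifP => ae bp h.
  by case E: (_ - _) => [|[|m]]; rewrite ?halving_sum0; lia.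
by case E: (b - a.+1) => [|[|[|m]]]; rewrite ?halving_sum0 ?halving_sumS /= ?halving_sum0; lia.
Qed.

Lemma persons_left1E O : O != set0 -> level O = 1 -> early_left O = 0 ->
  persons_left 1 O = gap_sum (taken O) p.+2 (fun a b => gap_max p a b == 1).
Proof.
move=> O0 l1; rewrite early_leftE // => /eqP; rewrite sum_nat_eq0 => /forallP E0.
apply: eq_bigr => e gab.
have := level1_gaps O0 l1 gab; have := gap_le gab; have := E0 e; rewrite gab /=.
case: e gab => a b /= gab.
rewrite /gap_max /gap_weight /early_gap; case: ifP => ae e0 bp h.
  by case E: (_ - _) => [|[|m]]; rewrite ?halving_sum0; lia.
by case E: (b - a.+1) => [|[|m]]; rewrite ?halving_sum0 ?halving_sumS /= ?halving_sum0; lia.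
Qed.

Lemma persons_leftE O : O != set0 -> 1 < level O ->
  persons_left (level O) O =
  gap_sum (taken O) p.+2 (fun a b => gap_max p a b == level O).
Proof.
move=> O0 l1; apply: eq_bigr => -[a b] /= gab.
have := gap_max_level O0 gab; have := gap_le gab.
rewrite /gap_max /gap_weight; case: ifP => ae bp h.
  case E: (_ - _) => [|m]; first by lia.
  by rewrite halving_sum_eq0 ?addn0 // => i hi; lia.
rewrite (@halving_sum_local (level O)) //; lia.
Qed.

Lemma completions_setT : completions setT = 1.
Proof.
rewrite /completions /pairs_left /persons_left /early_left !potential_full.
by rewrite !big1 => [|j _|j _]; rewrite ?potential_full.
Qed.

(* S is the class of gaps split next; Q is the product left after the split,
   without its power of 2. *)
Lemma completions_sum (C : pred 'I_p) (S : nat -> nat -> bool) O Q :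
  O != set0 -> (forall x, C x -> basic_choice O x) -> (forall a b, S a b -> a.+1 < b) ->
  (forall a b x, gap (taken O) a b -> a < x.+1 < b ->
     C x = S a b && (gap_dist p a b x.+1 == gap_max p a b)) ->
  0 < level O < p ->
  completions O = 2 ^ (\sum_(1 <= j < p) pairs_left j O) *
     (gap_sum (taken O) p.+2 (fun a b => S a b) * Q) ->
  (forall a b x, gap (taken O) a b -> a < x.+1 < b -> C x ->
    (early_left (x |: O))`!  * (persons_left 1 (x |: O) - early_left (x |: O))`!
  * \prod_(2 <= j < p) (persons_left j (x |: O))`! = Q) ->
  completions O = \sum_(x | C x) completions (x |: O).
Proof.
move=> O0 CO Slt HC lp FO FQ.
(* Doubling avoids fractions: an even inner gap uses up one factor of [2 ^ D] and has weight 1, any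
   other gap keeps all of [2 ^ D] and has weight 2. *)
apply/eqP; rewrite -(eqn_pmul2l (isT : 0 < 2)) big_distrr /=; apply/eqP.
set D := \sum_(1 <= j < p) pairs_left j O in FO *.
rewrite (@sum_choices p O C S _ (2 ^ D * Q)) //.
- by rewrite FO; lia.
- by move=> x /CO /basic_choice_empty.
move=> a b x gab hx Cx; rewrite /completions -2!mulnA [_`! * _]mulnA (FQ a b) //.
have bx := CO x Cx.
(* An even inner gap that is split has length twice [level O], so only the summand [j = level O]
   drops; [0 < level O < p] keeps it in range. *)
have -> : D = inner_even p a b + \sum_(1 <= j < p) pairs_left j (x |: O).
  rewrite /D (eq_bigr (fun j => gap_head p (fun m => m == j.*2) (fun=> 0) a b + pairs_left j (x |: O))); last first.
    by move=> j _; apply: potential_insert.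
  rewrite big_split /=; congr (_ + _).
  move: bx; rewrite (basic_choice_gap O0 gab hx) => /andP[_ /eqP hl].
  rewrite /gap_head /inner_even; move: hl; rewrite /gap_max; case: ifP => ae hl /=.
    by rewrite big1.
  case: (boolP (odd (b - a))) => od; last first.
    by rewrite big1_seq // => j _; apply/eqP; rewrite eqb0; lia.
  rewrite (big_cat_nat (n := level O)) /=; [|lia..].
  rewrite (big_cat_nat (n := (level O).+1) (m := level O)) /=; [|lia..].
  rewrite big_nat1 !big_nat big1 => [|j hj]; last by apply/eqP; rewrite eqb0; lia.
  by rewrite big1 => [|j hj]; [lia | apply/eqP; rewrite eqb0; lia].
by case: (inner_even p a b); rewrite ?add1n ?add0n ?expnS /= ?subn0 ?muln1; lia.
Qed.

Lemma prod_fact_decr (f g : nat -> nat) l : 1 < l < p ->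
  (forall j, f j = (j == l) + g j) ->
  \prod_(2 <= j < p) (f j)`! = f l * \prod_(2 <= j < p) (g j)`!.
Proof.
move=> hl H; rewrite (bigD1_seq l) ?mem_index_iota ?iota_uniq //=.
rewrite [in RHS](bigD1_seq l) ?mem_index_iota ?iota_uniq //=.
rewrite H eqxx add1n factS mulnA; congr (_ * _).
by apply: eq_bigr => j /negbTE jl; rewrite H jl.
Qed.

(** Three regimes, each an instance of [completions_sum]: level above 1, level 1 without early gaps,
    level 1 with early gaps. *)
Lemma completions_rec O : O != set0 -> O != setT ->
  completions O = \sum_(x | extended_choice O x) completions (x |: O).
Proof.
move=> O0 OT; have l0 := level_gt0 O0 OT.
have p0 : 0 < p by case/set0Pn: O0 => x _; apply: leq_trans (ltn_ord x).
have [x0 bx0] := level_attained OT.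
have [a0 [b0 [gab0 ax0 xb0 bp0]]] := empty_gap (basic_choice_empty bx0).
have hx0 : a0 < x0.+1 < b0 by rewrite ax0.
have lp : 0 < level O < p.
  have:= bx0; rewrite (basic_choice_gap O0 gab0 hx0) l0 => /andP[_ /eqP<-].
  exact: gap_max_lt gab0 p0.
have Mlt l a b : 0 < l -> gap_max p a b == l -> a.+1 < b.
  by rewrite /gap_max; case: ifP; lia.
have bgap a b x : gap (taken O) a b -> a < x.+1 < b -> basic_choice O x -> gap_max p a b = level O.
  by move=> gab hx; rewrite (basic_choice_gap O0 gab hx) => /andP[_ /eqP].
have step c ce a b x : gap (taken O) a b -> a < x.+1 < b -> basic_choice O x ->
   potential c ce O = gap_head p c ce a b + potential c ce (x |: O).
  by move=> *; apply: potential_insert.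
have cs (l1 : level O = 1) k a b x : 1 < k -> gap (taken O) a b -> a < x.+1 < b -> basic_choice O x ->
    persons_left k O = persons_left k (x |: O).
  move=> k1 gab hx bx; rewrite /persons_left (step _ _ _ _ _ gab hx bx) /gap_head.
  have := bgap _ _ _ gab hx bx; rewrite /gap_max l1; clear -k1; case: ifP; lia.
case: (ltngtP (level O) 1) => l1; first lia.
  (* Level above 1: gaps of maximal distance [level O] are split. The reference choice [x0] serves
     to name the product left afterwards. *)
  apply: (@completions_sum _ (fun a b => gap_max p a b == level O) _
     ((early_left (x0 |: O))`!  * (persons_left 1 (x0 |: O) - early_left (x0 |: O))`!
  * \prod_(2 <= j < p) (persons_left j (x0 |: O))`!)) => //.
  - by move=> x /andP[].
  - by move=> a b; apply: Mlt.
  - by move=> a b x gab hx; rewrite extended_choice_far // (basic_choice_gap O0 gab hx) andbC.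
  - rewrite -persons_leftE // /completions -!mulnA; congr (_ * _).
    have -> : early_left O = early_left (x0 |: O).
      rewrite /early_left (step _ _ _ _ _ gab0 hx0 bx0) /gap_head.
      by have := bgap _ _ _ gab0 hx0 bx0; rewrite /gap_max; case: ifP; lia.
    have H j : persons_left j O = (j == level O) + persons_left j (x0 |: O).
      rewrite /persons_left (step _ _ _ _ _ gab0 hx0 bx0) /gap_head.
      by have := bgap _ _ _ gab0 hx0 bx0; rewrite /gap_max; case: ifP; lia.
    rewrite (prod_fact_decr _ H); last lia.
    rewrite [persons_left 1 O]H; have -> : (1 == level O) = false by lia.
    by rewrite add0n; lia.
  move=> a b x gab hx /andP[bx _].
  have E c ce : gap_head p c ce a0 b0 = gap_head p c ce a b ->
    potential c ce (x |: O) = potential c ce (x0 |: O).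
    have := step c ce _ _ _ gab0 hx0 bx0; have := step c ce _ _ _ gab hx bx; lia.
  have m0 := bgap _ _ _ gab0 hx0 bx0; have m1 := bgap _ _ _ gab hx bx.
  have EU : early_left (x |: O) = early_left (x0 |: O).
    by apply: E; clear -m0 m1 l1; move: m0 m1; rewrite /gap_head /gap_max; do 2!case: ifP; lia.
  have EB k : persons_left k (x |: O) = persons_left k (x0 |: O).
    by apply: E; clear -m0 m1 l1; move: m0 m1; rewrite /gap_head /gap_max; do 2!case: ifP; lia.
  rewrite EU EB; congr (_ * _); apply: eq_bigr => j _; by rewrite EB.
(* Level 1 without early gaps: all best places have two occupied neighbours, and each choice lowers
   [persons_left 1] by one. *)
case: (posnP (early_left O)) => U0.
  have nE a b : gap (taken O) a b -> early_gap a b = false.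
    move=> gab; move/eqP: U0; rewrite early_leftE // sum_nat_eq0 => /forallP E0.
    have /andP[ab bp] := gap_le gab.
    have ha : a < p.+2 by lia.
    have hb : b < p.+2 by lia.
    by have := E0 (Ordinal ha, Ordinal hb); rewrite /= gab /= eqb0 => /negbTE.
  apply: (@completions_sum _ (fun a b => gap_max p a b == 1) _
     ((persons_left 1 O).-1`! * \prod_(2 <= j < p) (persons_left j O)`!)) => //.
  - by move=> x /andP[].
  - by move=> a b; apply: Mlt.
  - move=> a b x gab hx.
    have -> : extended_choice O x = basic_choice O x.
      rewrite /extended_choice; case: (boolP (basic_choice O x)) => //= bx.
      apply/forallP => y; apply/implyP => by_.
      have [a' [b' [gab' ay yb _]]] := empty_gap (basic_choice_empty by_).
      rewrite (neighbours_level1 O0 l1 gab hx bx) (neighbours_level1 O0 l1 gab' _ by_) ?ay //.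
      by rewrite !nE.
    by rewrite (basic_choice_gap O0 gab hx) andbC l1.
  - rewrite -persons_left1E // /completions U0 subn0 fact0 muln1 -!mulnA; congr (_ * _).
    have : 0 < persons_left 1 O.
      rewrite /persons_left (step _ _ _ _ _ gab0 hx0 bx0) /gap_head.
      by have := bgap _ _ _ gab0 hx0 bx0; rewrite /gap_max; case: ifP; lia.
    by case: persons_left => // k _; rewrite factS /= mulnA.
  move=> a b x gab hx /andP[bx _].
  have m1 := bgap _ _ _ gab hx bx.
  have := step (fun m => m == 2) (fun m => m == 1) _ _ _ gab hx bx.
  rewrite -/(early_left O) U0 -/(early_left (x |: O)) => /esym/eqP.
  rewrite addn_eq0 => /andP[_ /eqP->].
  have -> : persons_left 1 O = (persons_left 1 (x |: O)).+1.
    rewrite /persons_left (step _ _ _ _ _ gab hx bx) /gap_head.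
    by clear -m1 l1; move: m1; rewrite /gap_max; case: ifP; lia.
  rewrite subn0 fact0 mul1n /=; congr (_ * _).
  by apply: eq_big_nat => j /andP[j1 _]; rewrite (cs l1 _ _ _ _ j1 gab hx bx).
(* Level 1 with an early gap [g1, g2]: its best place [y] has one occupied neighbour and so rules
   out all gaps that are not early. [early_left] and [persons_left 1] drop together, which preserves
   their difference. *)
have [[g1 g2] /= /andP[gg eg]] : exists e : 'I_p.+2 * 'I_p.+2, gap (taken O) e.1 e.2 && early_gap e.1 e.2.
  apply/existsP; move: U0; rewrite early_leftE // lt0n; apply: contraR.
  rewrite negb_exists => /forallP H; rewrite sum_nat_eq0; apply/forallP => e.
  by apply/implyP => ge; have := H e; rewrite ge /= eqb0.
have early_max a b : early_gap a b -> gap_max p a b = 1.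
  by rewrite /early_gap /gap_max; case: ifP; lia.
have [y hy dy] : exists2 y : 'I_p, g1 < y.+1 < g2 & gap_dist p g1 g2 y.+1 = gap_max p g1 g2.
  apply: gap_max_attained; last by rewrite -ltnS.
  by move: eg; rewrite /early_gap; case: ifP; lia.
have by_ : basic_choice O y.
  by rewrite (basic_choice_gap O0 gg hy) dy eqxx (early_max _ _ eg) l1.
apply: (@completions_sum _ early_gap _
   ((early_left O).-1`! * (persons_left 1 O - early_left O)`! * \prod_(2 <= j < p) (persons_left j O)`!)) => //.
- by move=> x /andP[].
- by clear=> a b; rewrite /early_gap; case: ifP; lia.
- move=> a b x gab hx; rewrite /extended_choice.
  have bE : early_gap a b -> basic_choice O x = (gap_dist p a b x.+1 == gap_max p a b).
    by move=> eab; rewrite (basic_choice_gap O0 gab hx) (early_max _ _ eab) l1 andbT.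
  case: (boolP (early_gap a b)) => eab /=.
    rewrite bE // andb_idr // -bE // => bx.
    apply/forallP => z; apply/implyP => bz.
    have [a' [b' [gab' az zb _]]] := empty_gap (basic_choice_empty bz).
    rewrite (neighbours_level1 O0 l1 gab hx bx) (neighbours_level1 O0 l1 gab' _ bz) ?az //.
    by rewrite eab leq_sub2l ?leq_b1.
  apply/negP => /andP[bx /forallP/(_ y)]; rewrite by_ /=.
  rewrite (neighbours_level1 O0 l1 gab hx bx) (neighbours_level1 O0 l1 gg hy by_) eg.
  by rewrite (negbTE eab).
- rewrite -early_leftE // /completions -!mulnA; congr (_ * _).
  by case: (early_left O) U0 => // k _; rewrite factS /=; lia.
move=> a b x gab hx ex; have bx : basic_choice O x by case/andP: ex.
have eab : early_gap a b.
  case/andP: ex => _ /forallP/(_ y); rewrite by_ /=.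
  rewrite (neighbours_level1 O0 l1 gab hx bx) (neighbours_level1 O0 l1 gg hy by_) eg.
  by case: early_gap.
have -> : persons_left 1 O = (persons_left 1 (x |: O)).+1.
  rewrite /persons_left (step _ _ _ _ _ gab hx bx) /gap_head.
  by clear -eab; move: eab; rewrite /early_gap; case: ifP; lia.
have -> : early_left O = (early_left (x |: O)).+1.
  rewrite /early_left (step _ _ _ _ _ gab hx bx) /gap_head.
  by clear -eab; move: eab; rewrite /early_gap; case: ifP; lia.
rewrite subSS /=; congr (_ * _).
by apply: eq_big_nat => j /andP[j1 _]; rewrite (cs l1 _ _ _ _ j1 gab hx bx).
Qed.

End Completions.

(** * The places occupied in the course of a filling *)

Section Fillings.

Variable p : nat.
Implicit Types (s : {perm 'I_p}) (O : {set 'I_p}) (t u x : 'I_p).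

Lemma mem_occupied s n u : (s u \in occupied s n) = (u < n).
Proof.
apply/imsetP/idP => [[v + /perm_inj->]|un]; first by rewrite inE.
by exists u; rewrite ?inE.
Qed.

Lemma occupiedS s t : occupied s t.+1 = s t |: occupied s t.
Proof.
apply/setP => x; rewrite -[x](permKV s) in_setU1 !mem_occupied.
by rewrite (inj_eq perm_inj) -val_eqE /= ltnS leq_eqVlt.
Qed.

Lemma occupied0 s : occupied s 0 = set0.
Proof. by apply/setP => x; rewrite -[x](permKV s) mem_occupied inE. Qed.

Lemma occupied_full s : occupied s p = setT.
Proof. by apply/setP => x; rewrite -[x](permKV s) mem_occupied inE ltn_ord. Qed.

Lemma occupied_neq0 s t : 0 < t -> occupied s t != set0.
Proof.
move=> t0; have p0 : 0 < p by apply: leq_trans (ltn_ord t).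
by apply/set0Pn; exists (s (Ordinal p0)); rewrite mem_occupied.
Qed.

Lemma occupied_neqT s t : occupied s t != setT.
Proof. by apply/negP => /eqP/setP/(_ (s t)); rewrite mem_occupied ltnn inE. Qed.

Lemma eq_occupied s s' n : (forall u, u < n -> s u = s' u) -> occupied s n = occupied s' n.
Proof.
move=> H; apply/setP => x; apply/imsetP/imsetP => -[u]; rewrite inE => un ->.
  by exists u; rewrite ?inE ?H.
by exists u; rewrite ?inE -?H.
Qed.

(** * Counting the fillings that obey a given rule *)

Section Count.

Variables (C : {set 'I_p} -> 'I_p -> bool) (F : {set 'I_p} -> nat).
Hypothesis C_empty : forall O x, C O x -> x \notin O.
Hypothesis F_full : F setT = 1.
Hypothesis F_rec : forall O, O != set0 -> O != setT -> F O = \sum_(x | C O x) F (x |: O).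

Let obeys s := [forall t : 'I_p, (0 < t) ==> C (occupied s t) (s t)].

(** Induction on the number [p - n] of persons still to come: sorting the fillings by the place of
    the next one reproduces [F_rec]. *)
Lemma card_extensions n s0 : 0 < n <= p ->
  (forall t, 0 < t < n -> C (occupied s0 t) (s0 t)) ->
  #|[set s | obeys s && [forall u : 'I_p, (u < n) ==> (s u == s0 u)]]| = F (occupied s0 n).
Proof.
have [m] := ubnP (p - n); elim: m n s0 => // m IH n s0 pn /andP[n0 np] H0.
have agreeP s k : reflect (forall u, u < k -> s u = s0 u) [forall u : 'I_p, (u < k) ==> (s u == s0 u)].
  apply: (iffP forallP) => h u; first by move=> uk; apply/eqP/(implyP (h u)).
  by apply/implyP => uk; rewrite h.
case: (ltngtP n p) np => // [np _|np _]; last first.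
  rewrite np occupied_full F_full; apply: (@eq_card1 _ s0) => s; rewrite !inE.
  apply/andP/eqP => [[_ /agreeP H]|->]; first by apply/permP => u; apply: H; rewrite ltn_ord.
  split; last by apply/agreeP.
  by apply/forallP => t; apply/implyP => t0; apply: H0; rewrite t0 np ltn_ord.
pose T := Ordinal np.
rewrite F_rec ?(occupied_neq0 s0 (t := T)) ?(occupied_neqT s0 T) //.
rewrite -sum1_card (partition_big (fun s : {perm 'I_p} => s T) (fun x => C (occupied s0 n) x)) /=; last first.
  move=> s; rewrite inE => /andP[/forallP/(_ T) ob /agreeP ag].
  by rewrite -(eq_occupied ag); apply: (implyP ob).
apply: eq_bigr => x Cx; rewrite sum1dep_card.
(* any filling agreeing with s0 up to T serves as representative, valid or not *)
pose s1 := (s0 * tperm (s0 T) x)%g.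
have xO := C_empty Cx.
have s1E u : u < n -> s1 u = s0 u.
  move=> un; rewrite permM tpermD //.
    by rewrite (inj_eq perm_inj) -val_eqE /= gtn_eqF.
  by apply: contraNneq xO => ->; rewrite mem_occupied.
have s1T : s1 T = x by rewrite permM tpermL.
have -> : x |: occupied s0 n = occupied s1 n.+1.
  by rewrite (occupiedS s1 T) s1T (eq_occupied s1E).
rewrite -IH; [|lia|lia|].
  apply: eq_card => s; rewrite !inE -andbA; congr (_ && _).
  apply/andP/forallP => [[/agreeP ag /eqP sT] u|ag].
    apply/implyP; rewrite ltnS leq_eqVlt => /orP[/eqP un|un].
      by have -> : u = T by [exact: val_inj]; rewrite sT s1T.
    by rewrite ag // s1E.
  split; last by have := ag T; rewrite /= ltnS leqnn s1T.
  by apply/agreeP => u un; have := ag u; rewrite ltnS ltnW //= s1E // => /eqP.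
move=> t /andP[t0]; rewrite ltnS leq_eqVlt => /orP[/eqP tn|tn].
  have -> : t = T by exact: val_inj.
  by rewrite s1T /= (eq_occupied s1E).
rewrite s1E // (@eq_occupied s1 s0); first by apply: H0; rewrite t0.
by move=> u ut; apply: s1E; apply: ltn_trans tn.
Qed.

Lemma card_obeying : 0 < p -> #|[set s | obeys s]| = \sum_x F [set x].
Proof.
move=> p0; pose o := Ordinal p0.
rewrite -sum1_card (partition_big (fun s : {perm 'I_p} => s o) xpredT) //=.
apply: eq_bigr => x _; rewrite sum1dep_card.
have -> : [set x] = occupied (tperm o x) 1.
  by rewrite (occupiedS _ o) tpermL /= occupied0 setU0.
rewrite -card_extensions; [|by rewrite p0|by move=> t; lia].
apply: eq_card => s; rewrite !inE; congr (_ && _).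
apply/eqP/forallP => [sx u|/(_ o) /=]; last by rewrite tpermL => /eqP.
apply/implyP; rewrite ltnS leqn0 => /eqP u0; have -> : u = o by apply: val_inj.
by rewrite tpermL sx.
Qed.

End Count.

(** * The numbers b and d as potentials after the first choice *)

Lemma ord_telescope (f : nat -> nat) (g : 'I_p -> nat) : 0 < p ->
  f p = 0 -> (forall t : 'I_p, 0 < t -> f t = g t + f t.+1) ->
  \sum_(t : 'I_p | 0 < t) g t = f 1.
Proof.
move=> p0 fp H.
suff K m n : p - n <= m -> 0 < n <= p -> \sum_(t : 'I_p | n <= t) g t = f n.
  by apply: (K p); lia.
elim: m n => [|m IH] n hm /andP[n0 np].
  have -> : n = p by lia.
  by rewrite fp big_pred0 // => t; rewrite leqNgt ltn_ord.
case: (ltngtP n p) np => // [np _|-> _]; last first.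
  by rewrite fp big_pred0 // => t; rewrite leqNgt ltn_ord.
rewrite (bigD1 (Ordinal np)) //= (H (Ordinal np)) //= -IH; [|lia..].
congr (_ + _); apply: eq_bigl => t; rewrite -val_eqE /=; lia.
Qed.

Lemma persons_left_choice k O x : O != set0 -> basic_choice O x ->
  persons_left k O = (dist O x == k) + persons_left k (x |: O).
Proof.
move=> O0 bx; have [a [b [gab ax xb bp]]] := empty_gap (basic_choice_empty bx).
have hx : a < x.+1 < b by rewrite ax.
rewrite /persons_left (potential_insert _ _ O0 gab hx bx); congr (_ + _).
move: bx; rewrite (basic_choice_gap O0 gab hx) (dist_gap O0 gab hx) => /andP[/eqP-> _].
by clear -ax xb; rewrite /gap_head /gap_max; case: ifP; lia.
Qed.

Lemma persons_at_distanceE s k : 0 < p -> basic_filling s ->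
  persons_at_distance s k = persons_left k (occupied s 1).
Proof.
move=> p0 /forallP bs; rewrite /persons_at_distance -sum1dep_card big_mkcondr /=.
apply: (@ord_telescope (fun n => persons_left k (occupied s n))) => //.
  by rewrite occupied_full; apply: potential_full.
move=> t t0; rewrite occupiedS (@persons_left_choice _ _ (s t)) ?occupied_neq0 //.
exact: implyP (bs t) t0.
Qed.

Definition is_pair k O (e : 'I_p * 'I_p) :=
  [&& e.1 \notin O, e.2 \notin O, dist O e.1 == k & dist O e.2 == k].

(** No occupied place separates two neighbours, so both lie in one gap; equal distances then make
    them the two middle places of an even inner gap. *)
Lemma is_pair_gap k O (e : 'I_p * 'I_p) : O != set0 -> e.2 = e.1.+1 :> nat -> is_pair k O e ->
  exists a b, [/\ gap (taken O) a b, at_end p a b = false,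
     b = a + k.*2.+1, e.1.+1 = a + k & 0 < k].
Proof.
case: e => x y O0 /= xy /and4P[/= xO yO].
have [a [b [gab ax xb bp]]] := empty_gap xO.
have hx : a < x.+1 < b by rewrite ax.
have hy : a < y.+1 < b.
  have : y.+1 != b.
    apply: contraNneq yO => yb; case/gapP: gab => _ _ + _.
    by rewrite -yb takenS.
  by rewrite xy; lia.
rewrite (dist_gap O0 gab hx) (dist_gap O0 gab hy) => /eqP dx /eqP dy.
exists a, b; move: dx dy; rewrite xy /gap_dist /at_end.
have := gap_le gab; clear -gab hx hy xy; move: hx hy; rewrite xy.
case: eqP => a0 /=; first by lia.
by case: eqP => b0 /=; [lia|split=> //; lia].
Qed.

Lemma is_pair_of_gap k O a b (x y : 'I_p) : 0 < k -> O != set0 -> gap (taken O) a b ->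
  at_end p a b = false -> b = a + k.*2.+1 -> x.+1 = a + k -> y = x.+1 :> nat ->
  is_pair k O (x, y).
Proof.
move=> k0 O0 gab ae bE xE yE.
have hx : a < x.+1 < b by lia.
have hy : a < y.+1 < b by lia.
rewrite /is_pair /= (dist_gap O0 gab hx) (dist_gap O0 gab hy).
rewrite (gap_empty gab (x := x)) ?(gap_empty gab (x := y)) //=; try lia.
move: ae; rewrite /gap_dist /at_end; case: eqP => //= _; case: eqP => //= _ _.
by apply/andP; split; apply/eqP; clear -bE xE yE k0; lia.
Qed.

(** Backwards in time, the set [E n] of pairs seen from time [n] on gains a pair exactly when the
    gap split at [n] is inner of length [k.*2]. *)
Lemma pairs_at_distanceE s k : 0 < p -> 0 < k -> basic_filling s ->
  pairs_at_distance s k = pairs_left k (occupied s 1).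
Proof.
move=> p0 k0 /forallP bs.
pose E n := [set e : 'I_p * 'I_p | (e.2 == e.1.+1 :> nat) &&
      [exists t : 'I_p, (n <= t) && is_pair k (occupied s t) e]].
have <- : #|E 1| = pairs_at_distance s k by [].
suff K m n : p - n <= m -> 0 < n <= p -> #|E n| = pairs_left k (occupied s n).
  by apply: (K p); lia.
elim: m n => [|m IH] n hm /andP[n0 np].
  have -> : n = p by lia.
  rewrite occupied_full /pairs_left potential_full; apply: eq_card0 => e; rewrite !inE.
  apply/negP => /andP[_ /existsP[t /andP[]]]; by rewrite leqNgt ltn_ord.
case: (ltngtP n p) np => // [np _|-> _]; last first.
  rewrite occupied_full /pairs_left potential_full; apply: eq_card0 => e; rewrite !inE.
  apply/negP => /andP[_ /existsP[t /andP[]]]; by rewrite leqNgt ltn_ord.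
pose T := Ordinal np; pose O := occupied s n.
have O0 : O != set0 by apply: (@occupied_neq0 s T).
have bx : basic_choice O (s T) by apply: implyP (bs T) n0.
have OS : occupied s n.+1 = s T |: O by rewrite (occupiedS s T).
have [a [b [gab ax xb bp]]] := empty_gap (basic_choice_empty bx).
have hx : a < (s T).+1 < b by rewrite ax.
rewrite /pairs_left (potential_insert _ _ O0 gab hx bx) -OS -/(pairs_left k _) -IH; [|lia..].
have EE (e : 'I_p * 'I_p) : (e \in E n) = (e \in E n.+1) || ((e.2 == e.1.+1 :> nat) && is_pair k O e).
  rewrite !inE -andb_orr; congr (_ && _); apply/existsP/orP.
    case=> t /andP[]; rewrite leq_eqVlt => /orP[/eqP nt|nt] ip.
      by right; rewrite /O nt.
    by left; apply/existsP; exists t; rewrite nt.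
  case=> [/existsP[t /andP[nt ip]]|ip]; first by exists t; rewrite ltnW.
  by exists T; rewrite leqnn.
(* A pair in a gap other than the split one is still visible at the next time. *)
have stay (e : 'I_p * 'I_p) : e.2 = e.1.+1 :> nat -> is_pair k O e ->
    e \in E n.+1 \/ [/\ at_end p a b = false, b = a + k.*2.+1 & e.1.+1 = a + k].
  move=> e12 ip; have [c [d [gcd cd dE eE _]]] := is_pair_gap O0 e12 ip.
  case: (boolP ((c == a) && (d == b))) => [/andP[/eqP<- /eqP<-]|ne]; first by right.
  have gcd' : gap (taken (s T |: O)) c d.
    by rewrite (gap_insert gab hx (taken_insert O (s T))) gcd ne !orbT.
  have ip' : is_pair k (s T |: O) e.
    rewrite [e]surjective_pairing; apply: is_pair_of_gap gcd' _ _ _ _ => //.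
    by apply/set0Pn; exists (s T); rewrite setU11.
  have nS : n.+1 < p.
    rewrite ltn_neqAle np andbT; apply: contraTneq ip' => nS.
    by rewrite -OS nS occupied_full /is_pair inE.
  left; rewrite inE e12 eqxx /=; apply/existsP; exists (Ordinal nS).
  by rewrite leqnn /= OS.
rewrite /gap_head; case: (boolP (~~ at_end p a b && (b - a.+1 == k.*2))) => hd; last first.
  rewrite (_ : (if _ then 0 else _) = 0); last first.
    by move: hd; case: ifP => //= _ /negbTE->.
  apply: eq_card => e; rewrite EE; apply/orP/idP => [[//|/andP[/eqP e12 ip]]|]; last by left.
  case: (stay e e12 ip) => // -[ae bE _].
  by case/negP: hd; rewrite ae bE /=; lia.
case/andP: hd => /negbTE ae /eqP bE; rewrite ae bE eqxx.
have bE' : b = a + k.*2.+1 by lia.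
have bp' : b <> p.+1 by move: ae; rewrite /at_end; case: (b =P p.+1); rewrite ?orbT.
have h1 : (a + k).-1 < p by lia.
have h2 : a + k < p by lia.
pose e0 := (Ordinal h1, Ordinal h2).
have e0E : e0.2 = e0.1.+1 :> nat by rewrite /=; lia.
have ip0 : is_pair k O e0 by apply: is_pair_of_gap gab ae bE' _ e0E => //=; lia.
(* The person choosing now takes one of the two middle places, so [e0] is not seen again. *)
have e0N : e0 \notin E n.+1.
  rewrite inE e0E eqxx /=; apply/negP => /existsP[t /andP[nt /and4P[/= i1 i2 _ _]]].
  have sO : s T \in occupied s t by rewrite mem_occupied.
  have: s T = Ordinal h1 \/ s T = Ordinal h2.
    move: bx; rewrite (basic_choice_gap O0 gab hx) => /andP[/eqP + _].
    rewrite /gap_max ae; move: ae; rewrite /gap_dist /at_end.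
    case: eqP => //= a0; case: eqP => //= _ _ hd.
    have [h|h] : s T = (a + k).-1 :> nat \/ s T = a + k :> nat by clear -hd bE' a0 hx; lia.
      by left; apply: val_inj.
    by right; apply: val_inj.
  by case=> sE; [case/negP: i1|case/negP: i2]; rewrite -sE.
rewrite (_ : E n = e0 |: E n.+1) ?cardsU1 ?e0N //.
apply/setP => e; rewrite EE in_setU1 orbC; apply/orP/orP => -[].
- case/andP=> /eqP e12 ip; case: (stay e e12 ip) => [|[_ _ eE]]; first by right.
  left; apply/eqP; case: e e12 eE {ip} => x y /= xy xE.
  by congr (_, _); apply: val_inj => /=; lia.
- by right.
- by move/eqP->; left; rewrite e0E eqxx.
- by right.
Qed.

End Fillings.

(** * Evaluation after the first choice, and the theorem *)

Definition end_weight c ce m := if m is m'.+1 then ce m + halving_sum c m' else 0.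

(** The empty row is a single gap between the sentinels, whose weight cancels in [gap_sum_insert];
    two end gaps remain. *)
Lemma potential_set1 p c ce (x : 'I_p) :
  potential c ce [set x] = end_weight c ce x + end_weight c ce (p - x.+1).
Proof.
have g0 : gap (taken (set0 : {set 'I_p})) 0 p.+1.
  apply/gapP; split; rewrite ?takenp // => -[//|k] _ kp.
  by apply/negP => /takenP[|//|[y]]; [lia|lia|rewrite inE].
have hx : 0 < x.+1 < p.+1 by rewrite /= ltnS.
have M' k : taken [set x] k = (k == x.+1) || taken (set0 : {set 'I_p}) k
  by rewrite -(setU0 [set x]) taken_insert.
have := gap_sum_insert (gap_weight p c ce) g0 (leqnn _) hx M'.
rewrite (gap_sum_split _ g0) // big1 ?addn0; last first.
  move=> -[a b] /= /andP[/gapP[ab Ma Mb H]].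
  case/takenP: Ma => [a0|ap|[y]]; last by rewrite inE.
    case/takenP: Mb => [b0|bp|[y]]; last by rewrite inE.
      by rewrite b0 in ab.
    by rewrite a0 bp !eqxx.
  by have := ltn_ord b; lia.
rewrite /potential => /addIn ->; rewrite /gap_weight /at_end !eqxx orbT /=.
by rewrite subn1 /= subSS /end_weight; case: (p - _); case: (nat_of_ord x).
Qed.

(** A first person at the left end leaves one end gap of length [p.-1], whatever the later
    choices. *)
Lemma is_bE p k m : 0 < p -> is_b p k m ->
  m = end_weight (fun m => uphalf m == k) (fun m => m == k) p.-1.
Proof.
move=> p0 [s [bs /forallP/(_ (Ordinal p0)) /= sE ->]].
rewrite persons_at_distanceE // (occupiedS s (Ordinal p0)) /=.
by rewrite occupied0 setU0 /persons_left potential_set1 (eqP sE) add0n subn1.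
Qed.

Lemma is_dE p k m : 0 < p -> 0 < k -> is_d p k m ->
  m = end_weight (fun m => m == k.*2) (fun=> 0) p.-1.
Proof.
move=> p0 k0 [s [bs /forallP/(_ (Ordinal p0)) /= sE ->]].
rewrite pairs_at_distanceE // (occupiedS s (Ordinal p0)) /=.
by rewrite occupied0 setU0 /pairs_left potential_set1 (eqP sE) add0n subn1.
Qed.

(** Early inner gaps are those counted by d at distance 1. The extra term is an end gap of length 1,
    the source of the [+ 1] in the theorem. *)
Lemma end_weight_early m :
  end_weight (fun m => m == 2) (fun m => m == 1) m =
  end_weight (fun m => m == 1.*2) (fun=> 0) m + (m == 1).
Proof. by case: m => //= m; rewrite addnC. Qed.

Theorem mainTheorem8 (b d : nat -> nat -> nat)
    (hb : forall p k : nat, 0 < p -> 0 < k -> is_b p k (b p k))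
    (hd : forall p k : nat, 0 < p -> 0 < k -> is_d p k (d p k))
    (n : nat) (hn : 4 <= n) :
  A n =
      2 * 2 ^ d n 1 * (d n 1)`! * (b n 1 - d n 1)`!
        * \prod_(2 <= j < n) (2 ^ d n j * (b n j)`!)
    + 2 * 2 ^ d (n - 1) 1 * (d (n - 1) 1 + 1)`! * (b (n - 1) 1 - d (n - 1) 1)`!
        * \prod_(2 <= j < n) (2 ^ d (n - 1) j * (b (n - 1) j)`!)
    + \sum_(3 <= i < n - 1)
        (2 ^ (d i 1 + d (n + 1 - i) 1)
          * (d i 1 + d (n + 1 - i) 1)`!
          * (b i 1 + b (n + 1 - i) 1 - d i 1 - d (n + 1 - i) 1)`!
          * \prod_(2 <= j < n)
              (2 ^ (d i j + d (n + 1 - i) j) * (b i j + b (n + 1 - i) j)`!)).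
Proof.
have n0 : 0 < n by lia.
have bE p k : 0 < p -> 0 < k ->
    b p k = end_weight (fun m => uphalf m == k) (fun m => m == k) p.-1.
  by move=> p0 k0; apply: is_bE; last apply: hb.
have dE p k : 0 < p -> 0 < k ->
    d p k = end_weight (fun m => m == k.*2) (fun=> 0) p.-1.
  by move=> p0 k0; apply: is_dE; last apply: hd.
(* [G i] is the number of fillings that begin at place [i], counted from 1. The correction stands
   for an end gap of length 1: on the left for [i = 2], on the right for [i = n.-1]. *)
pose G i := 2 ^ (d i 1 + d (n + 1 - i) 1)
  * (d i 1 + d (n + 1 - i) 1 + ((i == 2) + (i == n.-1)))`!
  * (b i 1 + b (n + 1 - i) 1 - (d i 1 + d (n + 1 - i) 1 + ((i == 2) + (i == n.-1))))`!
  * \prod_(2 <= j < n) (2 ^ (d i j + d (n + 1 - i) j) * (b i j + b (n + 1 - i) j)`!).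
have AE : A n = \sum_(1 <= i < n.+1) G i.
  rewrite /A (card_obeying (F := @completions n)) //; first last.
  - exact: completions_rec.
  - exact: completions_setT.
  - by move=> O x /andP[/basic_choice_empty].
  rewrite big_add1 big_mkord; apply: eq_bigr => x _.
  have xn := ltn_ord x.
  (* Place [x] leaves end gaps of lengths [x] and [n - x.+1], as do rows of [x.+1] and [n - x]
     places once their leftmost place is taken. *)
  have B k : 0 < k -> persons_left k [set x] = b x.+1 k + b (n + 1 - x.+1) k.
    move=> k0; rewrite /persons_left potential_set1 !bE //; last lia.
    by rewrite addn1 subSS subnS.
  have D k : 0 < k -> pairs_left k [set x] = d x.+1 k + d (n + 1 - x.+1) k.
    move=> k0; rewrite /pairs_left potential_set1 !dE //; last lia.
    by rewrite addn1 subSS subnS.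
  have U : early_left [set x] = d x.+1 1 + d (n + 1 - x.+1) 1 + ((x.+1 == 2) + (x.+1 == n.-1)).
    rewrite -D // /early_left potential_set1 !end_weight_early.
    rewrite /pairs_left potential_set1 /=.
    have -> : (n - x.+1 == 1) = (x.+1 == n.-1) by lia.
    by rewrite eqSS; lia.
  rewrite /completions /G U B // (big_ltn (m := 1)); last lia.
  rewrite D // expnD expn_sum big_split /=.
  rewrite (eq_big_nat _ _ (F2 := fun j => 2 ^ (d x.+1 j + d (n + 1 - x.+1) j))); last first.
    by move=> j hj; rewrite D //; lia.
  rewrite (eq_big_nat _ _ (F1 := fun j => (persons_left j [set x])`!)
     (F2 := fun j => (b x.+1 j + b (n + 1 - x.+1) j)`!)); last first.
    by move=> j hj; rewrite B //; lia.
  lia.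
have b1 k : 0 < k -> b 1 k = 0 by move=> k0; rewrite bE.
have d1 k : 0 < k -> d 1 k = 0 by move=> k0; rewrite dE.
have b2 k : 0 < k -> b 2 k = (k == 1) by move=> k0; rewrite bE //= halving_sum0 addn0 eq_sym.
have d2 k : 0 < k -> d 2 k = 0 by move=> k0; rewrite dE.
(* Reflecting the row pairs [i] with [n + 1 - i]; this yields the factors 2 of the first two
   summands. *)
have Gsym i : 0 < i <= n -> G (n + 1 - i) = G i.
  move=> hi; rewrite /G; have -> : n + 1 - (n + 1 - i) = i by lia.
  have -> : (n + 1 - i == 2) = (i == n.-1) by lia.
  have -> : (n + 1 - i == n.-1) = (i == 2) by lia.
  rewrite [d (_ - _) 1 + _]addnC [b (_ - _) 1 + _]addnC [(i == n.-1) + _]addnC.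
  congr (_ * _); apply: eq_bigr => j _.
  by rewrite [d (_ - _) j + _]addnC [b (_ - _) j + _]addnC.
rewrite AE big_nat_recr //= big_ltn; last lia.
rewrite big_ltn; last lia.
have -> : \sum_(3 <= i < n) G i = \sum_(3 <= i < n - 1) G i + G (n - 1).
  by rewrite -{1}(subnK n0) addn1 big_nat_recr //=; lia.
have -> : G n = G 1 by rewrite -(Gsym 1) ?addnK.
have -> : G (n - 1) = G 2 by rewrite -(Gsym 2) //; [congr G|]; lia.
have G1 : G 1 = 2 ^ d n 1 * (d n 1)`! * (b n 1 - d n 1)`!
        * \prod_(2 <= j < n) (2 ^ d n j * (b n j)`!).
  rewrite /G addnK b1 // d1 // !add0n.
  have -> : (1 == n.-1) = false by lia.
  rewrite !addn0; congr (_ * _); apply: eq_big_nat => j hj.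
  by rewrite b1 ?d1 //; lia.
have G2 : G 2 = 2 ^ d (n - 1) 1 * (d (n - 1) 1 + 1)`! * (b (n - 1) 1 - d (n - 1) 1)`!
        * \prod_(2 <= j < n) (2 ^ d (n - 1) j * (b (n - 1) j)`!).
  rewrite /G; have -> : n + 1 - 2 = n - 1 by lia.
  have -> : (2 == n.-1) = false by lia.
  (* In the difference, [b 2 1 = 1] cancels the early end gap of length 1. *)
  rewrite b2 // d2 // !add0n addn0 [d (n - 1) 1 + _]addnC subnDl addnC.
  congr (_ * _); apply: eq_big_nat => j hj.
  rewrite b2 ?d2 //; try lia.
  by have -> : (j == 1) = false by lia.
rewrite G1 G2 [X in _ = _ + X](eq_big_nat _ _ (F2 := G)); first by rewrite -!mulnA; lia.
move=> i hi; rewrite /G.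
have -> : (i == 2) = false by lia.
have -> : (i == n.-1) = false by lia.
by rewrite !addn0 subnDA.
Qed.
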